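(* Let $p$ be a prime number and $n$ a positive integer such that $p$ does not divide $n$ and each group of order $np$ has a normal subgroup of order $p$. Then every left brace of size $np$ is (isomorphic to) a direct or semidirect product of the trivial brace of size $p$ and a left brace of size $n$.
   Context: A left brace is a set $B$ with two operations $+$ and $\cdot$ such that $(B,+)$ is an abelian group, $(B,\cdot)$ is a group, and $a(b+c)=ab-a+ac$ for all $a,b,c\in B$. A brace isomorphism is a bijection preserving both operations; $\mathrm{Aut}(B,+,\cdot)$ denotes the group of brace automorphisms. The trivial brace of size $p$ is $\mathbf{Z}_p=\mathbf{Z}/p\mathbf{Z}$ with $a\cdot b=a+b$; it is the unique left brace of size $p$ up to isomorphism. The direct product of left braces $B_1,B_2$ is $B_1\times B_2$ with componentwise $+$ and $\cdot$. Given a group morphism $\tau:(B_2,\cdot)\to\mathrm{Aut}(B_1,+,\cdot)$, $b\mapsto\tau_b$, the semidirect product of $B_1$ and $B_2$ via $\tau$ is the left brace $B_1\times B_2$ with $(a,b)+(a',b')=(a+a',b+b')$ and $(a,b)\cdot(a',b')=(a\,\tau_b(a'),\,bb')$. In the statement, $B_1$ is the trivial brace of size $p$ and $B_2$ is the left brace of size $n$. *)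

(* Defs.v *)
From HB Require Import structures.
From mathcomp Require Import all_boot all_order all_fingroup all_algebra.

Set Implicit Arguments.
Unset Strict Implicit.
Unset Printing Implicit Defensive.

Import GRing.Theory.
Local Open Scope ring_scope.

(* Addition is the [zmodType] operation (in [ring_scope]); multiplication is
   the [groupType] operation (in [group_scope]). *)
HB.mixin Record Zmodule_Group_isLeftBrace B
    of GRing.Zmodule B & monoid.Group B := {
  mulgDr_brace : forall a b c : B,
    (a * (b + c)%R)%g = (a * b)%g - a + (a * c)%g
}.

#[short(type="leftBraceType")]
HB.structure Definition LeftBrace :=
  { B of Zmodule_Group_isLeftBrace B & GRing.Zmodule B & monoid.Group B }.

#[short(type="finLeftBraceType")]
HB.structure Definition FinLeftBrace := { B of LeftBrace B & Finite B }.

Definition brace_isomorphism (B C : leftBraceType) (f : B -> C) : Prop :=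
  [/\ bijective f,
      {morph f : x y / x + y} &
      {morph f : x y / (x * y)%g}].

Definition brace_isomorphic (B C : leftBraceType) : Prop :=
  exists f : B -> C, brace_isomorphism f.

Definition trivial_brace (A : Type) : Type := A.

Section TrivialBrace.
Variable A : zmodType.

HB.instance Definition _ := GRing.Zmodule.copy (trivial_brace A) A.

HB.instance Definition _ := isGroup.Build (trivial_brace A)
  (@addrA A) (@add0r A) (@addr0 A) (@addNr A) (@addrN A).

Fact trivial_brace_subproof (a b c : trivial_brace A) :
  (a * (b + c)%R)%g = (a * b)%g - a + (a * c)%g.
Proof.
by change (a + (b + c) = a + b - a + (a + c) :> A);
  rewrite [a + b]addrC addrK addrCA.
Qed.
HB.instance Definition _ :=
  Zmodule_Group_isLeftBrace.Build (trivial_brace A) trivial_brace_subproof.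
End TrivialBrace.

Lemma trivial_brace_mulE (A : zmodType) (a b : trivial_brace A) :
  (a * b)%g = a + b.
Proof. by []. Qed.

HB.instance Definition _ (A : finZmodType) := Finite.copy (trivial_brace A) A.

Section DirectProduct.
Variables B1 B2 : leftBraceType.

Fact prod_brace_subproof (a b c : (B1 * B2)%type) :
  (a * (b + c)%R)%g = (a * b)%g - a + (a * c)%g.
Proof. by congr (_, _); exact: mulgDr_brace. Qed.
HB.instance Definition _ :=
  Zmodule_Group_isLeftBrace.Build (B1 * B2)%type prod_brace_subproof.

Lemma prod_brace_addE (x y : (B1 * B2)%type) : x + y = (x.1 + y.1, x.2 + y.2).
Proof. by []. Qed.

Lemma prod_brace_mulE (x y : (B1 * B2)%type) :
  (x * y)%g = ((x.1 * y.1)%g, (x.2 * y.2)%g).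
Proof. by []. Qed.
End DirectProduct.

Section BraceAut.
Variable B : finLeftBraceType.

Definition is_brace_aut (s : {perm B}) : bool :=
  [forall x : B, forall y : B,
     (s (x + y) == s x + s y) && (s (x * y)%g == (s x * s y)%g)].

Lemma is_brace_autP (s : {perm B}) : reflect (brace_isomorphism s) (is_brace_aut s).
Proof.
apply: (iffP forallP) => [sP | [_ sD sM] x].
  split; first exact: injF_bij perm_inj.
    by move=> x y; have /forallP/(_ y)/andP[/eqP] := sP x.
  by move=> x y; have /forallP/(_ y)/andP[_ /eqP] := sP x.
by apply/forallP => y; rewrite sD sM !eqxx.
Qed.

Record brace_aut := BraceAut { brace_aut_perm :> {perm B};
                               brace_aut_isP : is_brace_aut brace_aut_perm }.
HB.instance Definition _ := [isSub for brace_aut_perm].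
HB.instance Definition _ := [Finite of brace_aut by <:].

Fact one_autP : is_brace_aut 1%g.
Proof. by apply/forallP=> x; apply/forallP=> y; rewrite !perm1 !eqxx. Qed.

(* [{perm B}] composes left to right: [(s * t)%g x = t (s x)]. The group of
   brace automorphisms is given the usual product [s \o t], hence the swap. *)
Fact mul_autP (s t : brace_aut) : is_brace_aut (val t * val s)%g.
Proof.
have /is_brace_autP[_ sD sM] := valP s; have /is_brace_autP[_ tD tM] := valP t.
by apply/forallP=> x; apply/forallP=> y; rewrite !permM tD tM sD sM !eqxx.
Qed.

Fact inv_autP (s : brace_aut) : is_brace_aut (val s)^-1%g.
Proof.
have /is_brace_autP[_ sD sM] := valP s.
apply/forallP=> x; apply/forallP=> y.
by apply/andP; split; apply/eqP; apply: (@perm_inj _ (val s));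
  rewrite ?sD ?sM !permKV.
Qed.

Definition one_aut := BraceAut one_autP.
Definition mul_aut s t := BraceAut (mul_autP s t).
Definition inv_aut s := BraceAut (inv_autP s).

Fact mul_autA : associative mul_aut.
Proof. by move=> s t u; apply: val_inj; rewrite /= mulgA. Qed.
Fact mul_1aut : left_id one_aut mul_aut.
Proof. by move=> s; apply: val_inj; rewrite /= mulg1. Qed.
Fact mul_Vaut : left_inverse one_aut inv_aut mul_aut.
Proof. by move=> s; apply: val_inj; rewrite /= mulgV. Qed.

HB.instance Definition _ :=
  Finite_isGroup.Build brace_aut mul_autA mul_1aut mul_Vaut.

Lemma brace_autM (s t : brace_aut) x : (s * t)%g x = s (t x).
Proof. exact: permM. Qed.

End BraceAut.

Definition semidirect_brace (B1 B2 : finLeftBraceType)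
  (tau : {multiplicative B2 -> brace_aut B1}) : Type := (B1 * B2)%type.

Section SemidirectProduct.
Variables (B1 B2 : finLeftBraceType).
Variable tau : {multiplicative B2 -> brace_aut B1}.
Local Notation S := (semidirect_brace tau).

HB.instance Definition _ := Finite.copy S (B1 * B2)%type.
HB.instance Definition _ := GRing.Zmodule.copy S (B1 * B2)%type.

Definition sd_mul (x y : S) : S := ((x.1 * tau x.2 y.1)%g, (x.2 * y.2)%g).
Definition sd_one : S := (1%g, 1%g).
Definition sd_inv (x : S) : S := (tau (x.2^-1)%g (x.1^-1)%g, (x.2^-1)%g).

Let tauM b c x : tau (b * c)%g x = tau b (tau c x).
Proof. by rewrite gmulfM brace_autM. Qed.

Let tau1 x : tau 1%g x = x.
Proof. by apply: (@perm_inj _ (tau 1%g)); rewrite -tauM mulg1. Qed.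

Let tauD b : {morph tau b : x y / x + y}.
Proof. by have /is_brace_autP[] := valP (tau b). Qed.

Let tauMl b : {morph tau b : x y / (x * y)%g}.
Proof. by have /is_brace_autP[] := valP (tau b). Qed.

Let tau_1 b : tau b 1%g = 1%g.
Proof. by apply: (mulgI (tau b 1%g)); rewrite -tauMl !mulg1. Qed.

Fact sd_mulA : associative sd_mul.
Proof. by move=> x y z; rewrite /sd_mul /= tauM tauMl !mulgA. Qed.

Fact sd_mul1 : left_id sd_one sd_mul.
Proof. by case=> x y; rewrite /sd_mul /= tau1 !mul1g. Qed.

Fact sd_mulV : left_inverse sd_one sd_inv sd_mul.
Proof. by case=> x y; rewrite /sd_mul /= -tauMl !mulVg tau_1. Qed.

HB.instance Definition _ := Finite_isGroup.Build S sd_mulA sd_mul1 sd_mulV.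

Fact sd_subproof (a b c : S) :
  (a * (b + c)%R)%g = (a * b)%g - a + (a * c)%g.
Proof.
by congr (_, _); rewrite /= ?tauD; exact: mulgDr_brace.
Qed.
HB.instance Definition _ := Zmodule_Group_isLeftBrace.Build S sd_subproof.

Lemma semidirect_brace_addE (x y : S) : x + y = (x.1 + y.1, x.2 + y.2).
Proof. by []. Qed.

Lemma semidirect_brace_mulE (x y : S) :
  (x * y)%g = ((x.1 * tau x.2 y.1)%g, (x.2 * y.2)%g).
Proof. by []. Qed.

End SemidirectProduct.

(* Main.v *)
Require Import Defs.
From HB Require Import structures.
From mathcomp Require Import all_boot all_order all_fingroup all_algebra.
From mathcomp Require Import all_solvable.

Set Implicit Arguments.
Unset Strict Implicit.
Unset Printing Implicit Defensive.

Import GRing.Theory.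
Local Open Scope ring_scope.

(** In a left brace, [a * b = a + lambda_a(b)], where each [lambda_a] is an
    additive automorphism and [lambda] turns products into composites.  The
    elements killed by [m] are therefore stable under every [lambda_a], hence
    form a subbrace (not just an additive subgroup).  If [#|B| = p * n] with
    [p] and [n] coprime, the additive group is the direct sum of its
    [p]-torsion [P] and its [n]-torsion [H], of orders [p] and [n]
    ([card_torsion]).  Three facts then determine the multiplication.

    - [P] is a multiplicative subgroup of order [p]; a normal subgroup of that
      order is a normal Hall subgroup, so it contains [P] and equals it
      ([torsion_group_normal]).  This is the only use of the hypothesis on
      groups of order [n * p].

    - For [a] in [P] and [b] in [H], [a * b = a + b]
      ([mul_torsion_coprime]): [lambda_a(b) - b] lies in [H] because [H] is
      stable under [lambda], and in [P] because [P] is normal.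

    - [P] is the trivial brace ([mul_torsion_prime]): it acts on its own
      additive group, cyclic of order [p], whose automorphism group has
      order [p - 1], so the action is trivial.

    Hence [(a + b) * (a' + b') = a b a' b' = a (b a' b^-1) b b'], which equals
    [(a + b a' b^-1) + b b'].  So [(a, b) |-> a + b] is an isomorphism onto [B]
    from the semidirect product given by the conjugation action of [H] on [P]
    ([internal_semidirect_brace]).  This covers the direct product, as the
    case of a trivial action. *)

(** * The lambda map and the torsion subbraces of a left brace *)

Section Lambda.
Variable B : leftBraceType.
Implicit Types (a b c x : B) (m k : nat).

Definition lambda a b : B := (a * b)%g - a.

Lemma mul_lambda a b : (a * b)%g = a + lambda a b.
Proof. by rewrite /lambda addrC subrK. Qed.

(** Distributivity at [1 * (0 + 0)] leaves [0 = - 1]. *)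
Lemma brace_one_zero : 1%g = 0 :> B.
Proof.
have := mulgDr_brace (1%g : B) 0 0.
by rewrite !mul1g !addr0 add0r => /eqP; rewrite eq_sym oppr_eq0 => /eqP.
Qed.

(** This is the brace axiom, with [a] subtracted from both sides. *)
Lemma lambdaD a : {morph lambda a : b c / b + c}.
Proof. by move=> b c; rewrite /lambda mulgDr_brace addrA. Qed.

Lemma lambda0 a : lambda a 0 = 0.
Proof. by rewrite /lambda -[X in (a * X)%g]brace_one_zero mulg1 subrr. Qed.

Lemma lambdaMn a b k : lambda a (b *+ k) = lambda a b *+ k.
Proof. by elim: k => [|k IH]; rewrite ?lambda0 // !mulrS lambdaD IH. Qed.

Lemma lambda_mul a b x : lambda (a * b)%g x = lambda a (lambda b x).
Proof.
apply: (addIr (lambda a b)); rewrite -lambdaD addrC [lambda b x + b]addrC.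
by rewrite -mul_lambda /lambda mulgA addrC addrA subrK.
Qed.

Lemma lambda1 x : lambda 1%g x = x.
Proof. by rewrite /lambda mul1g brace_one_zero subr0. Qed.

Definition torsion m : {pred B} := [pred x | x *+ m == 0].

Lemma torsionP m x : reflect (x *+ m = 0) (x \in torsion m).
Proof. exact: eqP. Qed.

Lemma torsion_mulrn_mod m x i : x \in torsion m -> x *+ i = x *+ (i %% m).
Proof.
move=> /torsionP xm.
by rewrite {1}(divn_eq i m) mulrnDr mulnC mulrnA xm mul0rn add0r.
Qed.

Lemma torsion_zmod_closed m : zmod_closed (torsion m).
Proof.
split=> [|x y /torsionP xm /torsionP ym]; apply/torsionP; first exact: mul0rn.
by rewrite mulrnBl xm ym subr0.
Qed.

Lemma torsion_lambda m a x : x \in torsion m -> lambda a x \in torsion m.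
Proof.
by move=> /torsionP xm; apply/torsionP; rewrite -lambdaMn xm lambda0.
Qed.

(** Products and inverses are expressed by addition and lambda:
    [x * y = x + lambda_x(y)] and [y^-1 = - lambda_(y^-1)(y)]; additive
    subgroups stable under lambda are therefore multiplicative subgroups. *)
Lemma torsion_group_closed m : group_closed (torsion m).
Proof.
have [T0 TB] := torsion_zmod_closed m.
have TD := Algebra.zmod_closedD (torsion_zmod_closed m).
split=> [|x y Tx Ty]; first by rewrite brace_one_zero.
have Vy: y^-1%g = - lambda y^-1%g y.
  by rewrite /lambda mulVg brace_one_zero sub0r opprK.
rewrite mul_lambda; apply: TD => //; apply: torsion_lambda.
by rewrite Vy -sub0r; apply: TB => //; apply: torsion_lambda.
Qed.

Lemma torsion_coprime m k x :
  coprime m k -> x \in torsion m -> x \in torsion k -> x = 0.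
Proof.
case: m => [|m] co_mk /torsionP xm /torsionP xk.
  by move: co_mk xk; rewrite /coprime gcd0n => /eqP->.
case: (egcdnP k (ltn0Sn m)) => u v def_uv _.
have := congr1 (GRing.natmul x) def_uv.
rewrite (eqP co_mk) mulrnDr [(u * _)%N]mulnC [(v * _)%N]mulnC !mulrnA.
by rewrite xm xk !mul0rn add0r.
Qed.

(** The claim is that [lambda_a(b) - b = 0].  This difference has order
    dividing [k], like [b].  Writing [a * b = b * a ^ b], it is also
    [lambda_b(a ^ b) - a], which has order dividing [m] because conjugates of
    [a] do. *)
Lemma mul_torsion_coprime m k a b :
    (forall x y, x \in torsion m -> (x ^ y)%g \in torsion m) ->
  coprime m k -> a \in torsion m -> b \in torsion k -> (a * b)%g = a + b.
Proof.
move=> Tconj co_mk Ta Tb; have [_ TBm] := torsion_zmod_closed m.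
have [_ TBk] := torsion_zmod_closed k.
have swap: lambda a b - b = lambda b (a ^ b)%g - a.
  by rewrite /lambda -conjgC addrAC.
rewrite mul_lambda; congr (_ + _); apply/eqP; rewrite -subr_eq0; apply/eqP.
apply: (torsion_coprime co_mk); last by apply: TBk => //; apply: torsion_lambda.
by rewrite swap; apply: TBm => //; apply: torsion_lambda; apply: Tconj.
Qed.

End Lambda.

Arguments torsion : clear implicits.

Record torsion_brace (B : leftBraceType) (m : nat) :=
  TorsionBrace { torsion_val :> B; _ : torsion_val \in torsion B m }.

HB.instance Definition _ (B : leftBraceType) m :=
  [isSub for @torsion_val B m].
HB.instance Definition _ (B : leftBraceType) m :=
  [Choice of torsion_brace B m by <:].
HB.instance Definition _ (B : leftBraceType) m :=
  GRing.SubChoice_isSubZmodule.Build B _ (torsion_brace B m)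
    (torsion_zmod_closed B m).
HB.instance Definition _ (B : leftBraceType) m :=
  SubChoice_isSubGroup.Build B _ (torsion_brace B m)
    (torsion_group_closed B m).

Fact torsion_brace_subproof (B : leftBraceType) m (a b c : torsion_brace B m) :
  (a * (b + c)%R)%g = (a * b)%g - a + (a * c)%g.
Proof. by apply: val_inj; exact: mulgDr_brace. Qed.
HB.instance Definition _ (B : leftBraceType) m :=
  Zmodule_Group_isLeftBrace.Build (torsion_brace B m)
    (@torsion_brace_subproof B m).
HB.instance Definition _ (B : finLeftBraceType) m :=
  [Finite of torsion_brace B m by <:].

(** * Counting in finite left braces *)

Section FiniteBrace.
Variable B : finLeftBraceType.
Implicit Types (a b x : B) (m k : nat).

Lemma expg_trivial_brace (x : trivial_brace B) m : (x ^+ m)%g = x *+ m.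
Proof. by elim: m => // m IH; rewrite expgS mulrS IH. Qed.

(** In the additive group, the [m]-torsion is the [pi]-core for the set [pi] of
    prime divisors of [m], and by coprimality that Hall subgroup has
    order [m].  The brace [trivial_brace B] serves to see this additive group
    as a multiplicative one. *)
Lemma card_torsion m k :
  #|B| = (m * k)%N -> coprime m k -> #|torsion B m| = m.
Proof.
move=> cardB co_mk; pose G := [set: trivial_brace B]%G.
have cardG: #|G| = (m * k)%N by rewrite cardsT -cardB.
have /andP[m_gt0 k_gt0] : (0 < m)%N && (0 < k)%N.
  by rewrite -muln_gt0 -cardG cardG_gt0.
have abG: abelian G by apply/centsP=> x _ y _; exact: addrC.
have hallH := nilpotent_pcore_Hall \pi(m) (abelian_nil abG).
have cardH: #|'O_\pi(m)(G)%g| = m.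
  rewrite (card_Hall hallH) cardG partnM // part_pnat_id ?pnat_pi //.
  by rewrite part_p'nat ?muln1 // -coprime_pi'.
rewrite -[RHS]cardH; apply: eq_card => x.
rewrite [in RHS](mem_normal_Hall hallH (pcore_normal _ _)) ?inE //.
apply/eqP/idP => [xm | pi_x].
  apply: pnat_dvd (pnat_pi m_gt0).
  by rewrite order_dvdn expg_trivial_brace; apply/eqP.
have Hx: x \in 'O_\pi(m)(G)%g.
  by rewrite (mem_normal_Hall hallH (pcore_normal _ _)) ?inE.
by have := order_dvdG Hx; rewrite cardH order_dvdn expg_trivial_brace => /eqP.
Qed.

Fact torsion_group_set m : group_set [set x in torsion B m].
Proof.
have TM := group_closedM (torsion_group_closed B m).
apply/group_setP; split=> [|x y]; rewrite !inE; last exact: TM.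
by case: (torsion_group_closed B m).
Qed.

Canonical torsion_group m := Group (torsion_group_set m).

(** A normal Hall subgroup contains every subgroup whose order involves only
    its primes, so it contains the [m]-torsion, which has the same order. *)
Lemma torsion_group_normal m k (N : {group B}) :
    #|B| = (m * k)%N -> coprime m k ->
  (N <| [set: B])%g -> #|N| = m -> N = torsion_group m.
Proof.
move=> cardB co_mk nsN cardN.
have cardT: #|torsion_group m| = m by rewrite cardsE (card_torsion cardB).
have /andP[m_gt0 k_gt0] : (0 < m)%N && (0 < k)%N.
  by rewrite -muln_gt0 -cardB -cardsT cardG_gt0.
have hallN: (\pi(m).-Hall([set: B]) N)%g.
  rewrite pHallE subsetT /= cardN cardsT cardB partnM //.
  by rewrite part_pnat_id ?pnat_pi // part_p'nat ?muln1 // -coprime_pi'.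
apply/esym/eqP; rewrite -val_eqE /= eqEcard cardT cardN leqnn andbT.
by rewrite (sub_normal_Hall hallN nsN) ?subsetT // /pgroup cardT pnat_pi.
Qed.

Section PrimeTorsion.
Variable p : nat.
Hypotheses (p_prime : prime p) (card_p : #|torsion B p| = p).

Lemma torsion_prime_cyclic : exists g,
  forall x, x \in torsion B p <-> exists i, x = g *+ i.
Proof.
have [g Tg nz_g] : exists2 g, g \in torsion B p & g != 0.
  have [] := boolP [exists g, (g \in torsion B p) && (g != 0)].
    by case/existsP=> g /andP[]; exists g.
  move/existsPn=> T0; have: (#|torsion B p| <= #|pred1 (0%R : B)|)%N.
    apply/subset_leq_card/subsetP => x Tx.
    by have := T0 x; rewrite Tx negbK.
  by rewrite card1 card_p leqNgt prime_gt1.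
have Tgi i: g *+ i \in torsion B p.
  by apply/torsionP; rewrite mulrnAC (torsionP _ _ Tg) mul0rn.
exists g => x; split=> [Tx | [i ->] //].
have og: #[g : trivial_brace B]%g = p.
  by apply: nt_prime_order => //; rewrite expg_trivial_brace; apply/torsionP.
have sgT: <[g : trivial_brace B]>%g \subset [set x | x \in torsion B p].
  by apply/subsetP=> _ /cycleP[i ->]; rewrite inE expg_trivial_brace Tgi.
have /eqP eq_gT : <[g : trivial_brace B]>%g == [set x | x \in torsion B p].
  by rewrite eqEcard sgT cardsE card_p -orderE og leqnn.
have: x \in <[g : trivial_brace B]>%g by rewrite eq_gT inE.
by case/cycleP=> i ->; exists i; rewrite expg_trivial_brace.
Qed.

(** If [lambda_a(g) = k g] on a generator [g], then [lambda_(a ^ p)(g)] is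
    [k ^ p g = k g] by Fermat's little theorem, while [a ^ p = 1]: hence
    [k g = g]. *)
Lemma mul_torsion_prime a b :
  a \in torsion B p -> b \in torsion B p -> (a * b)%g = a + b.
Proof.
have [g genT] := torsion_prime_cyclic.
move=> Ta /genT[j ->]; rewrite mul_lambda lambdaMn; congr (_ + _ *+ j).
have Tg: g \in torsion B p by apply/genT; exists 1%N.
have /genT[k lam_k] := torsion_lambda a Tg.
have lam_exp i: lambda (a ^+ i)%g g = g *+ (k ^ i).
  elim: i => [|i IH]; first by rewrite expg0 lambda1.
  by rewrite expgS lambda_mul IH lambdaMn lam_k expnS mulrnA.
have ap1: (a ^+ p)%g = 1%g.
  have Ga: a \in torsion_group p by rewrite inE.
  by have := expg_cardG Ga; rewrite cardsE card_p.
have fermat: (k ^ p = k %[mod p])%N.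
  have := pFrobenius_aut_nat (pchar_Fp p_prime) k.
  rewrite pFrobenius_autE -natrX => /(congr1 val).
  by rewrite /= !val_Fp_nat.
by rewrite lam_k (torsion_mulrn_mod k Tg) -fermat -torsion_mulrn_mod // -lam_exp
  ap1 lambda1.
Qed.

Lemma torsion_prime_embedding : exists f : trivial_brace 'Z_p -> B,
  [/\ injective f, {morph f : i j / i + j}, {morph f : i j / (i * j)%g} &
      forall x, x \in torsion B p <-> exists i, x = f i].
Proof.
have [g genT] := torsion_prime_cyclic.
have Tg: g \in torsion B p by apply/genT; exists 1%N.
have cardZp: (Zp_trunc p).+2 = p by rewrite Zp_cast ?prime_gt1.
have g_mod i: g *+ i = g *+ (i %% (Zp_trunc p).+2).
  by rewrite cardZp -torsion_mulrn_mod.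
pose f (i : trivial_brace 'Z_p) := g *+ (i : 'Z_p).
have fD: {morph f : i j / i + j}.
  by move=> i j; rewrite /f -mulrnDr [RHS]g_mod.
have fT x : x \in torsion B p <-> exists i, x = f i.
  split=> [/genT[i ->] | [i ->]]; last by apply/genT; exists (i : 'Z_p).
  by exists (inZp i : 'Z_p); rewrite /f /= -g_mod.
have Tf i: f i \in torsion B p by apply/fT; exists i.
exists f; split=> //; last by move=> i j; rewrite mul_torsion_prime -?fD.
apply/injectiveP/card_uniqP; rewrite size_map -cardE.
transitivity #|torsion B p|; last by rewrite card_p card_ord cardZp.
apply: eq_card => x.
by apply/codomP/idP => [/fT | /fT].
Qed.

End PrimeTorsion.
End FiniteBrace.

(** * Recognition of semidirect products *)

Lemma brace_isomorphic_sym (B C : leftBraceType) :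
  brace_isomorphic B C -> brace_isomorphic C B.
Proof.
case=> f [[g fK gK] fD fM]; exists g; split; first by exists f.
  by move=> x y; apply: (can_inj fK); rewrite fD !gK.
by move=> x y; apply: (can_inj fK); rewrite fM !gK.
Qed.

(** Conjugation by [g c] preserves the product; it preserves the sum because
    sum and product agree on a trivial brace. *)
Lemma conjugation_brace_aut (V : finZmodType) (B C : finLeftBraceType)
    (f : trivial_brace V -> B) (g : C -> B) :
    injective f -> {morph f : a b / (a * b)%g} ->
    {morph g : c d / (c * d)%g} ->
    (forall c a, exists a', f a' = (g c * f a * (g c)^-1)%g) ->
  exists tau : {multiplicative C -> brace_aut (trivial_brace V)},
    forall c a, f (tau c a) = (g c * f a * (g c)^-1)%g.
Proof.
move=> f_inj fM gM f_conj.
have /fin_all_exists[h hE] : forall ca : C * trivial_brace V,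
    exists a', f a' = (g ca.1 * f ca.2 * (g ca.1)^-1)%g.
  by case=> c a; exact: f_conj.
have h_inj c: injective (fun a => h (c, a)).
  move=> a b /(congr1 f); rewrite !hE /=.
  by move=> /mulIg/mulgI/f_inj.
have hM c: {morph (fun a => h (c, a)) : a b / (a * b)%g}.
  by move=> a b; apply: f_inj; rewrite fM !hE /= fM !mulgA mulgKV.
have autP c: is_brace_aut (perm (@h_inj c)).
  apply/is_brace_autP; split; first exact: injF_bij perm_inj.
    by move=> a b; rewrite !permE; exact: hM.
  by move=> a b; rewrite !permE; exact: hM.
pose tau c : brace_aut (trivial_brace V) := BraceAut (autP c).
have tauE c a: f (tau c a) = (g c * f a * (g c)^-1)%g by rewrite permE hE.
have tauM: {morph tau : c d / (c * d)%g}.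
  move=> c d; apply/val_inj/permP => a; apply: f_inj.
  by rewrite [LHS]tauE brace_autM !tauE gM invMg !mulgA.
pose tau_mixin :=
  isMultiplicative.Build C (brace_aut (trivial_brace V)) tau tauM.
pose tau' : {multiplicative C -> brace_aut (trivial_brace V)} :=
  HB.pack tau tau_mixin.
by exists tau'.
Qed.

(** The isomorphism is the inverse of [(a, c) |-> f a + g c = f a * g c].
    It is additive in the first form and multiplicative in the second; the
    cardinality hypothesis turns injectivity into bijectivity. *)
Lemma internal_semidirect_brace (A C B : finLeftBraceType)
    (tau : {multiplicative C -> brace_aut A}) (f : A -> B) (g : C -> B) :
    injective f -> {morph f : a b / a + b} -> {morph f : a b / (a * b)%g} ->
    injective g -> {morph g : c d / c + d} -> {morph g : c d / (c * d)%g} ->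
    (forall a c, f a = g c -> a = 0) -> #|B| = (#|A| * #|C|)%N ->
    (forall a c, (f a * g c)%g = f a + g c) ->
    (forall c a, f (tau c a) = (g c * f a * (g c)^-1)%g) ->
  brace_isomorphic B (semidirect_brace tau).
Proof.
move=> f_inj fD fM g_inj gD gM fg0 cardB fgM tauE; apply: brace_isomorphic_sym.
pose h (x : semidirect_brace tau) : B := f x.1 + g x.2.
have h_inj: injective h.
  move=> [a c] [a' c']; rewrite /h /= => eq_h.
  have: f (a - a') = g (c' - c).
    apply: (addIr (f a')); rewrite -fD subrK; apply: (addIr (g c)).
    by rewrite eq_h addrAC -gD subrK addrC.
  move/fg0/eqP; rewrite subr_eq0 => /eqP eq_a; rewrite eq_a in eq_h *.
  by move/addrI/g_inj: eq_h => ->.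
exists h; split.
- by apply: inj_card_bij; rewrite // cardB -card_prod.
- by move=> x y; rewrite /h /= fD gD addrACA.
move=> x y; rewrite /h -!fgM /= fM tauE gM.
by rewrite !mulgA mulgKV.
Qed.

(** * Braces of size [n * p] *)

Local Close Scope ring_scope.

Theorem proposition2 (p n : nat) (p_prime : prime p) (n_gt0 : 0 < n)
    (p_ndvd_n : ~~ (p %| n))
    (normal_p : forall (gT : finGroupType) (G : {group gT}),
       #|G| = n * p -> exists N : {group gT}, (N <| G)%g /\ #|N| = p)
    (B : finLeftBraceType) (cardB : #|B| = n * p) :
  exists B2 : finLeftBraceType,
    #|B2| = n /\
    (brace_isomorphic B (trivial_brace 'Z_p * B2)%type \/
     exists tau : {multiplicative B2 -> brace_aut (trivial_brace 'Z_p)},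
       brace_isomorphic B (semidirect_brace tau)).
Proof.
have co_pn: coprime p n by rewrite prime_coprime.
have cardB': #|B| = (p * n)%N by rewrite mulnC.
have card_p: #|torsion B p| = p by rewrite (card_torsion cardB').
have card_n: #|torsion B n| = n.
  by rewrite (card_torsion cardB) // coprime_sym.
have [N [nsN cardN]] : exists N : {group B}, (N <| [set: B])%g /\ #|N| = p.
  by apply: normal_p; rewrite cardsT.
have T_conj x y : x \in torsion B p -> (x ^ y)%g \in torsion B p.
  have := nsN; rewrite (torsion_group_normal cardB' co_pn nsN cardN) => nsT Tx.
  have Ny: (y \in 'N(torsion_group B p))%g.
    by rewrite (subsetP (normal_norm nsT)) ?inE.
  by have := memJ_norm x Ny; move: Tx; rewrite !inE => ->.
have [f [f_inj fD fM fT]] := torsion_prime_embedding p_prime card_p.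
have Tf i: f i \in torsion B p by apply/fT; exists i.
pose C : finLeftBraceType := torsion_brace B n.
have cardC: #|C| = n by rewrite card_sub.
pose g (c : C) : B := torsion_val c.
have [tau tauE] :
    exists tau : {multiplicative C -> brace_aut (trivial_brace 'Z_p)},
    forall c i, f (tau c i) = (g c * f i * (g c)^-1)%g.
  apply: conjugation_brace_aut => // c i.
  have /fT[j fj] := T_conj _ (g c)^-1%g (Tf i); exists j.
  by rewrite -fj conjgE invgK mulgA.
exists C; split=> //; right; exists tau.
apply: (internal_semidirect_brace (f := f) (g := g)) => //.
- exact: val_inj.
- move=> i c fi_gc; apply: f_inj.
  have f0: f 0%R = 0%R by apply: (addIr (f 0%R)); rewrite -fD !add0r.
  rewrite f0; apply: (torsion_coprime co_pn) => //.
  by rewrite fi_gc; exact: valP.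
- by rewrite cardC card_ord Zp_cast ?prime_gt1.
by move=> i c; apply: (mul_torsion_coprime T_conj co_pn) => //; exact: valP.
Qed.
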